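(* Let $m\ge 0$ be an integer, let $q>2m+3$, and set $\alpha=\frac{q-3-2m}{q-1}\in(0,1)$. Then the function $u(x)=\operatorname{sign}(x)\,|x|^\alpha$ on $(-1,1)\subset\mathbb{R}$, which is not Lipschitz at $0$, is a viscosity solution of $$\arctan(u'')=-\arctan\left(c\,x^{2m+1}\,(u')^q\right),\qquad c=(1-\alpha)\,\alpha^{1-q}>0.$$ The phase $\Theta(x,p)=-\arctan(c\,x^{2m+1}p^q)$ fails the uniform $C^2$ bound in $x$: $|\Theta_{xx}|$ is unbounded over $x\in(-1,1)$ and $p\in\{u'(y):0<|y|<1\}$.
   Context: A continuous function $u$ is a viscosity solution of $\arctan(u'')=\Theta(x,u,u')$ on an open interval if, for every $x_0$ and every $C^2$ function $\varphi$ near $x_0$ with $\varphi(x_0)=u(x_0)$: if $\varphi\ge u$ near $x_0$ then $\arctan\varphi''(x_0)\ge\Theta(x_0,u(x_0),\varphi'(x_0))$, and if $\varphi\le u$ near $x_0$ then $\arctan\varphi''(x_0)\le\Theta(x_0,u(x_0),\varphi'(x_0))$. The phase is given by the formula for $p>0$ and may be extended arbitrarily to $p\le0$ when $p^q$ is not defined there. *)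

(* Defs.v *)
From Stdlib Require Import Reals.
From Coquelicot Require Import Coquelicot.
Open Scope R_scope.

(* [Derive_n] is total, so the existence of every derivative of order at most
   two has to be required explicitly: [ex_derive_n f 2 y] by itself only speaks
   of the derivative of the total function [Derive f]. *)
Definition C2_near (f : R -> R) (x0 : R) : Prop :=
  locally x0 (fun y =>
    (forall k : nat, (k <= 2)%nat -> ex_derive_n f k y) /\
    continuous (Derive_n f 2) y).

(* Viscosity solutions of arctan(u'') = Theta(x, u, u') on the interval (a, b);
   the values of [u] outside (a, b) are irrelevant. *)
Definition viscosity_solution (Theta : R -> R -> R -> R) (a b : R)
    (u : R -> R) : Prop :=
  (forall x : R, a < x < b -> continuous u x) /\
  (forall (x0 : R) (phi : R -> R),
     a < x0 < b -> C2_near phi x0 -> phi x0 = u x0 ->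
     (locally x0 (fun y => phi y >= u y) ->
        atan (Derive_n phi 2 x0) >= Theta x0 (u x0) (Derive phi x0)) /\
     (locally x0 (fun y => phi y <= u y) ->
        atan (Derive_n phi 2 x0) <= Theta x0 (u x0) (Derive phi x0))).

Definition Lipschitz_at (f : R -> R) (x0 : R) : Prop :=
  exists L : R, locally x0 (fun y => Rabs (f y - f x0) <= L * Rabs (y - x0)).

(* sign(x) |x|^alpha.  [Rpower 0 alpha] is 1, not 0, but [sign 0 = 0], so the
   value at the origin is 0 as it should be. *)
Definition signed_power (alpha x : R) : R := sign x * Rpower (Rabs x) alpha.

(* Main.v *)
(** Away from the origin u is smooth and solves the equation classically, so a
    touching test function has the same slope and an ordered second derivative.
    At the origin u is steeper than every Lipschitz function on both sides, so no
    C^2 function touches it there and the viscosity condition is void.  For the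
    phase, with K = c p^q and n = 2m+1, the second derivative of
    -atan (K x^n) at the point where K x^n = 1 equals n / (2 x^2); such a
    slope p is attained by u for every 0 < x < 1 because
    c alpha^q = alpha (1 - alpha) < 1. *)
Require Import Defs.
From Stdlib Require Import Reals Lra Lia.
From Coquelicot Require Import Coquelicot.
Open Scope R_scope.

(** * First- and second-order conditions at a touching point *)

Lemma negative_right_of_zero (g : R -> R) (x0 l : R) :
  is_derive g x0 l -> g x0 = 0 -> l < 0 ->
  exists d : posreal, forall x, x0 < x < x0 + d -> g x < 0.
Proof.
  intros Hg H0 Hl.
  apply is_derive_Reals in Hg.
  destruct (Hg (- l)) as [d Hd]; [lra|].
  exists d; intros x Hx.
  specialize (Hd (x - x0)).
  rewrite H0 in Hd.
  replace (x0 + (x - x0)) with x in Hd by ring.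
  assert (Hq : Rabs ((g x - 0) / (x - x0) - l) < - l).
  { apply Hd; [lra|]. rewrite Rabs_pos_eq; lra. }
  apply Rabs_lt_between in Hq.
  replace (g x) with ((g x - 0) / (x - x0) * (x - x0)) by (field; lra).
  nra.
Qed.

(** Fermat's rule gives the first claim. If [l] were negative, [df] would be negative just to the
    right of [x0], and the mean value theorem would push [f] below its minimum 0 there. *)
Lemma local_minimum_second_order (f df : R -> R) (x0 l : R) :
  locally x0 (fun y => 0 <= f y) -> f x0 = 0 ->
  locally x0 (fun y => is_derive f y (df y)) -> is_derive df x0 l ->
  df x0 = 0 /\ 0 <= l.
Proof.
  intros [d1 Hpos] H0 [d2 Hdf] Hl.
  assert (Hball : forall (d : posreal) y, Rabs (y - x0) < d -> ball x0 d y)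
    by (intros d y Hy; exact Hy).
  assert (Hdf0 : df x0 = 0).
  { assert (Hx0 : derivable_pt_lim f x0 (df x0)).
    { apply is_derive_Reals, Hdf, ball_center. }
    pose (pr := exist _ (df x0) Hx0 : derivable_pt f x0).
    change (derive_pt f x0 pr = 0).
    destruct d1 as [d1 Hd1]; simpl in *.
    apply (deriv_minimum f (x0 - d1) (x0 + d1) x0 pr); try lra.
    intros x Hx1 Hx2; rewrite H0; apply Hpos, (Hball (mkposreal d1 Hd1)).
    apply Rabs_lt_between; simpl; lra. }
  split; [exact Hdf0|].
  destruct (Rle_lt_dec 0 l) as [Hl0|Hl0]; [exact Hl0|exfalso].
  destruct (negative_right_of_zero df x0 l Hl Hdf0 Hl0) as [d3 Hneg].
  set (d := Rmin d1 (Rmin d2 d3)).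
  assert (Hd : 0 < d /\ d <= d1 /\ d <= d2 /\ d <= d3).
  { unfold d. destruct d1, d2, d3; simpl.
    repeat apply Rmin_case_strong; intros; lra. }
  assert (Hdd : forall y, x0 <= y <= x0 + d / 2 -> is_derive f y (df y)).
  { intros y Hy. apply Hdf, Hball. rewrite Rabs_pos_eq; lra. }
  destruct (MVT_cor2 f df x0 (x0 + d / 2)) as (z & Hz & Hzi); [lra| |].
  { intros y Hy; apply is_derive_Reals, Hdd, Hy. }
  assert (Hz0 : df z < 0) by (apply Hneg; lra).
  assert (Hf : 0 <= f (x0 + d / 2)).
  { apply Hpos, Hball. rewrite Rabs_pos_eq; lra. }
  rewrite H0 in Hz. nra.
Qed.

Lemma touching_from_above (f g df dg : R -> R) (x0 k l : R) :
  locally x0 (fun y => g y <= f y) -> f x0 = g x0 ->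
  locally x0 (fun y => is_derive f y (df y)) -> is_derive df x0 k ->
  locally x0 (fun y => is_derive g y (dg y)) -> is_derive dg x0 l ->
  df x0 = dg x0 /\ l <= k.
Proof.
  intros Hfg H0 Hf Hk Hg Hl.
  destruct (local_minimum_second_order (fun y => minus (f y) (g y))
              (fun y => minus (df y) (dg y)) x0 (minus k l)) as [H1 H2].
  - revert Hfg; apply filter_imp; intros y Hy.
    unfold minus, plus, opp; simpl; lra.
  - unfold minus, plus, opp; simpl; lra.
  - generalize (filter_and _ _ Hf Hg); apply filter_imp; intros y [Hy1 Hy2].
    now apply (is_derive_minus (V := R_NormedModule)).
  - now apply (is_derive_minus (V := R_NormedModule)).
  - unfold minus, plus, opp in H1, H2; simpl in H1, H2; lra.
Qed.

(** * Handling of the C^2 condition *)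

Lemma C2_near_derivatives (phi : R -> R) (x0 : R) :
  C2_near phi x0 ->
  locally x0 (fun y => is_derive phi y (Derive phi y)) /\
  is_derive (Derive phi) x0 (Derive_n phi 2 x0).
Proof.
  unfold C2_near; intros H; split.
  - revert H; apply filter_imp; intros y [Hy _].
    apply Derive_correct, (Hy 1%nat); lia.
  - apply locally_singleton in H; destruct H as [H _].
    apply Derive_correct, (H 2%nat); lia.
Qed.

Lemma C2_near_ext (f g : R -> R) (x0 : R) :
  (forall t, f t = g t) -> C2_near f x0 -> C2_near g x0.
Proof.
  intros Hfg; unfold C2_near; apply filter_imp; intros y [H1 H2]; split.
  - intros k Hk; apply ex_derive_n_ext with f; auto.
  - apply continuous_ext with (Derive_n f 2); auto.
    intros z; now apply Derive_n_ext.
Qed.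

Lemma C2_near_intro (f df ddf : R -> R) (x0 : R) :
  (forall y, is_derive f y (df y)) -> (forall y, is_derive df y (ddf y)) ->
  (forall y, continuous ddf y) ->
  C2_near f x0 /\ Derive_n f 2 x0 = ddf x0.
Proof.
  intros H1 H2 H3.
  assert (E1 : forall y, Derive f y = df y)
    by (intros y; apply is_derive_unique, H1).
  assert (E2 : forall y, Derive_n f 2 y = ddf y).
  { intros y; simpl; rewrite (Derive_ext _ df) by exact E1.
    apply is_derive_unique, H2. }
  split; [unfold C2_near|apply E2].
  apply filter_forall; intros y; split.
  - intros [|[|[|k]]] Hk; [exact I| | |lia].
    + exists (df y); apply H1.
    + exists (ddf y); simpl.
      apply is_derive_ext with df; [now intros; rewrite E1|apply H2].
  - apply continuous_ext with ddf; [now intros; rewrite E2|apply H3].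
Qed.

(** * Calculus of the signed power *)

Lemma sign_sqr (x : R) : x <> 0 -> sign x * sign x = 1.
Proof.
  intros Hx; destruct (Rdichotomy _ _ Hx) as [H|H].
  - rewrite sign_eq_m1 by exact H; ring.
  - rewrite sign_eq_1 by exact H; ring.
Qed.

Lemma sign_Rabs (x : R) : sign x * Rabs x = x.
Proof.
  destruct (Rtotal_order x 0) as [H|[H|H]].
  - rewrite sign_eq_m1, Rabs_left by exact H; ring.
  - subst; rewrite sign_0; ring.
  - rewrite sign_eq_1, Rabs_pos_eq by lra; ring.
Qed.

Lemma locally_sign (x : R) : x <> 0 -> locally x (fun y => sign y = sign x).
Proof.
  intros Hx; destruct (Rdichotomy _ _ Hx) as [H|H].
  - generalize (open_lt 0 x H); apply filter_imp; intros y Hy.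
    now rewrite !sign_eq_m1.
  - generalize (open_gt 0 x H); apply filter_imp; intros y Hy.
    now rewrite !sign_eq_1.
Qed.

(** Turns the integer power of the phase into a real one, so that its exponent can be added to the
    one coming from [Rpower p q]. *)
Lemma odd_pow_sign (m : nat) (x : R) : x <> 0 ->
  x ^ (2 * m + 1) = sign x * Rpower (Rabs x) (2 * INR m + 1).
Proof.
  intros Hx.
  replace (2 * INR m + 1) with (INR (2 * m + 1))
    by (rewrite plus_INR, mult_INR; reflexivity).
  rewrite Rpower_pow by now apply Rabs_pos_lt.
  rewrite <- (sign_Rabs x) at 1.
  rewrite Rpow_mult_distr, pow_add, pow_mult, pow_1.
  replace (sign x ^ 2) with 1 by (simpl; rewrite Rmult_1_r, sign_sqr; auto).
  rewrite pow1; ring.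
Qed.

Lemma is_derive_Rpower_Rabs (a x : R) : x <> 0 ->
  is_derive (fun t => Rpower (Rabs t) a) x
    (sign x * (a * Rpower (Rabs x) (a - 1))).
Proof.
  intros Hx.
  apply (is_derive_comp (fun t => Rpower t a) Rabs).
  - apply is_derive_Reals, derivable_pt_lim_power, Rabs_pos_lt, Hx.
  - rewrite <- (Rmult_1_r (sign x)).
    apply (is_derive_Rabs (fun t => t)); [apply (is_derive_id (K := R_AbsRing))|exact Hx].
Qed.

Lemma is_derive_signed_power (a x : R) : x <> 0 ->
  is_derive (signed_power a) x (a * Rpower (Rabs x) (a - 1)).
Proof.
  intros Hx.
  (* The sign is locally constant, so only the power of [Rabs t] is differentiated; this yields a
     second factor [sign x], and the two cancel. *)
  apply (is_derive_ext_loc (fun t => sign x * Rpower (Rabs t) a)).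
  { generalize (locally_sign x Hx); apply filter_imp; intros y Hy.
    unfold signed_power; now rewrite Hy. }
  replace (a * Rpower (Rabs x) (a - 1))
    with (sign x * (sign x * (a * Rpower (Rabs x) (a - 1)))).
  - apply is_derive_scal, is_derive_Rpower_Rabs, Hx.
  - rewrite <- Rmult_assoc, sign_sqr by exact Hx; ring.
Qed.

Lemma signed_power_0 (a : R) : signed_power a 0 = 0.
Proof. unfold signed_power; rewrite sign_0; ring. Qed.

Lemma signed_power_pos (a x : R) : 0 < x -> signed_power a x = Rpower x a.
Proof.
  intros Hx; unfold signed_power.
  rewrite sign_eq_1, Rabs_pos_eq by lra; ring.
Qed.

Lemma signed_power_opp (a x : R) : signed_power a (- x) = - signed_power a x.
Proof. unfold signed_power; rewrite sign_opp, Rabs_Ropp; ring. Qed.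

Lemma continuous_signed_power (a x : R) : 0 < a -> continuous (signed_power a) x.
Proof.
  intros Ha; destruct (Req_dec x 0) as [->|Hx].
  - apply filterlim_locally; intros eps.
    (* The radius is the solution [d] of d^a = eps. *)
    assert (Hd : 0 < Rpower eps (/ a)) by apply exp_pos.
    exists (mkposreal _ Hd); intros y Hy.
    change (Rabs (y - 0) < Rpower eps (/ a)) in Hy.
    change (Rabs (signed_power a y - signed_power a 0) < eps).
    rewrite signed_power_0, Rminus_0_r; rewrite Rminus_0_r in Hy.
    destruct (Req_dec y 0) as [->|Hy0].
    { rewrite signed_power_0, Rabs_R0; apply cond_pos. }
    unfold signed_power.
    replace (Rabs (sign y * Rpower (Rabs y) a)) with (Rpower (Rabs y) a).
    + replace (pos eps) with (Rpower (Rpower eps (/ a)) a).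
      * apply Rlt_Rpower_l; [exact Ha|].
        split; [now apply Rabs_pos_lt|exact Hy].
      * rewrite Rpower_mult, Rinv_l by lra; apply Rpower_1, cond_pos.
    + rewrite Rabs_mult, (Rabs_pos_eq (Rpower _ _)) by (left; apply exp_pos).
      destruct (Rdichotomy _ _ Hy0).
      * rewrite sign_eq_m1, (Rabs_left (-1)) by lra; ring.
      * rewrite sign_eq_1, Rabs_R1 by assumption; ring.
  - apply (ex_derive_continuous (V := R_NormedModule)).
    eexists; apply is_derive_signed_power, Hx.
Qed.

(** * Steepness at the origin excludes test functions there *)

Lemma Rpower_exceeds_linear (a L d : R) : a < 1 -> 0 < d ->
  exists y, 0 < y < d /\ L * y < Rpower y a.
Proof.
  intros Ha Hd.
  (* For 0 < y <= e one has (a - 1) ln y >= |L|, hence y^(a-1) >= 1 + |L| > L. *)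
  set (e := exp (- (Rabs L / (1 - a)))).
  assert (He : 0 < e) by apply exp_pos.
  set (y := Rmin (d / 2) e).
  assert (Hy : 0 < y /\ y <= d / 2 /\ y <= e)
    by (unfold y; apply Rmin_case_strong; intros; lra).
  exists y; split; [lra|].
  assert (Hln : ln y <= - (Rabs L / (1 - a))).
  { rewrite <- (ln_exp (- (Rabs L / (1 - a)))).
    apply ln_le; [lra|apply Hy]. }
  assert (HL : Rabs L <= (a - 1) * ln y).
  { replace (Rabs L) with ((1 - a) * (Rabs L / (1 - a))) by (field; lra).
    nra. }
  assert (Hexp : L < Rpower y (a - 1)).
  { unfold Rpower. generalize (exp_ineq1_le ((a - 1) * ln y)) (Rle_abs L); lra. }
  replace a with ((a - 1) + 1) by ring.
  rewrite Rpower_plus, Rpower_1 by lra.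
  apply Rmult_lt_compat_r; lra.
Qed.

Lemma signed_power_not_Lipschitz (a : R) : a < 1 -> ~ Lipschitz_at (signed_power a) 0.
Proof.
  intros Ha [L [d Hd]].
  destruct (Rpower_exceeds_linear a L d Ha (cond_pos d)) as (y & Hy & Hlt).
  specialize (Hd y).
  rewrite signed_power_0, signed_power_pos, !Rminus_0_r in Hd by lra.
  rewrite !Rabs_pos_eq in Hd; try lra; [|left; apply exp_pos].
  apply Rlt_not_le in Hlt; apply Hlt, Hd.
  change (Rabs (y - 0) < d); rewrite Rabs_pos_eq; lra.
Qed.

Lemma differentiable_Lipschitz_at (f : R -> R) (x0 l : R) :
  is_derive f x0 l -> Lipschitz_at f x0.
Proof.
  intros Hf; apply is_derive_Reals in Hf.
  (* Near [x0] the difference quotient stays within 1 of [l], which makes |l| + 1 a Lipschitz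
     constant. *)
  destruct (Hf 1 Rlt_0_1) as [d Hd].
  exists (Rabs l + 1), d; intros y Hy; change R in y.
  change (Rabs (y - x0) < d) in Hy.
  destruct (Req_dec y x0) as [->|Hne].
  { rewrite !Rminus_diag, !Rabs_R0; lra. }
  specialize (Hd (y - x0)).
  replace (x0 + (y - x0)) with y in Hd by ring.
  assert (Hq : Rabs ((f y - f x0) / (y - x0) - l) < 1) by (apply Hd; lra).
  replace (f y - f x0) with ((f y - f x0) / (y - x0) * (y - x0)) by (field; lra).
  rewrite Rabs_mult; apply Rmult_le_compat_r; [apply Rabs_pos|].
  generalize (Rabs_triang_inv ((f y - f x0) / (y - x0)) l); lra.
Qed.

Lemma Lipschitz_at_not_above (a : R) (phi : R -> R) : a < 1 ->
  Lipschitz_at phi 0 -> phi 0 = 0 ->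
  ~ locally 0 (fun y => phi y >= signed_power a y).
Proof.
  intros Ha [L HL] H0 Habove.
  destruct (filter_and _ _ HL Habove) as [d Hd].
  destruct (Rpower_exceeds_linear a L d Ha (cond_pos d)) as (y & Hy & Hlt).
  destruct (Hd y) as [H1 H2].
  { change (Rabs (y - 0) < d); rewrite Rabs_pos_eq; lra. }
  rewrite signed_power_pos in H2 by lra.
  rewrite H0, !Rminus_0_r, (Rabs_pos_eq y) in H1 by lra.
  generalize (Rle_abs (phi y)); lra.
Qed.

Lemma Lipschitz_at_not_below (a : R) (phi : R -> R) : a < 1 ->
  Lipschitz_at phi 0 -> phi 0 = 0 ->
  ~ locally 0 (fun y => phi y <= signed_power a y).
Proof.
  intros Ha [L HL] H0 Hbelow.
  destruct (filter_and _ _ HL Hbelow) as [d Hd].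
  destruct (Rpower_exceeds_linear a L d Ha (cond_pos d)) as (y & Hy & Hlt).
  (* Contact from below fails on the left: at [- y] the value -y^a lies under -L y, hence under
     [phi]. *)
  destruct (Hd (- y)) as [H1 H2].
  { change (Rabs (- y - 0) < d); rewrite Rminus_0_r, Rabs_Ropp, Rabs_pos_eq; lra. }
  rewrite signed_power_opp, signed_power_pos in H2 by lra.
  rewrite H0, !Rminus_0_r, Rabs_Ropp, (Rabs_pos_eq y) in H1 by lra.
  generalize (Rle_abs (- phi (- y))); rewrite Rabs_Ropp; lra.
Qed.

(** * From the classical equation off the origin to the viscosity property *)

Lemma signed_power_viscosity (Theta : R -> R -> R) (a lo hi : R) :
  0 < a < 1 ->
  (forall x, x <> 0 ->
     Theta x (a * Rpower (Rabs x) (a - 1)) =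
     atan (a * (sign x * ((a - 1) * Rpower (Rabs x) (a - 1 - 1))))) ->
  viscosity_solution (fun x _ p => Theta x p) lo hi (signed_power a).
Proof.
  intros Ha HTheta; split.
  { intros x _; apply continuous_signed_power; lra. }
  intros x0 phi _ Hphi H0.
  destruct (C2_near_derivatives _ _ Hphi) as [Hd1 Hd2].
  destruct (Req_dec x0 0) as [->|Hx0].
  - rewrite signed_power_0 in H0.
    assert (HL : Lipschitz_at phi 0).
    { eapply differentiable_Lipschitz_at, (locally_singleton _ _ Hd1). }
    split; intros Ht; exfalso; revert Ht.
    + apply Lipschitz_at_not_above; tauto.
    + apply Lipschitz_at_not_below; tauto.
  - assert (Hu1 : locally x0 (fun y => is_derive (signed_power a) y
                     (a * Rpower (Rabs y) (a - 1)))).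
    { generalize (open_neq 0 x0 Hx0); apply filter_imp.
      intros y Hy; now apply is_derive_signed_power. }
    assert (Hu2 := is_derive_scal _ _ a _ (is_derive_Rpower_Rabs (a - 1) x0 Hx0)).
    assert (Hmono : forall s t, s <= t -> atan s <= atan t).
    { intros s t [Hst| ->]; [left; now apply atan_increasing|right; reflexivity]. }
    split; intros Ht.
    + destruct (touching_from_above phi (signed_power a) _ _ x0 _ _
                  (filter_imp _ _ (fun y => Rge_le _ _) Ht) H0 Hd1 Hd2 Hu1 Hu2)
        as [E Hle].
      rewrite E, HTheta by exact Hx0.
      now apply Rle_ge, Hmono.
    (* The same comparison with the roles exchanged: the signed power now lies above the test
       function. *)
    + destruct (touching_from_above (signed_power a) phi _ _ x0 _ _
                  Ht (eq_sym H0) Hu1 Hu2 Hd1 Hd2) as [E Hle].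
      rewrite <- E, HTheta by exact Hx0.
      now apply Hmono.
Qed.

(** * Second derivative of the phase in x *)

Lemma atan_odd_power_C2 (K : R) (m : nat) (x : R) :
  K * x ^ (2 * m + 1) = 1 ->
  C2_near (fun t => - atan (K * t ^ (2 * m + 1))) x /\
  Derive_n (fun t => - atan (K * t ^ (2 * m + 1))) 2 x
    = (2 * INR m + 1) / (2 * x ^ 2).
Proof.
  intros HK.
  assert (Hden : forall s, 1 + s * s <> 0) by (intros s; nra).
  set (n := (2 * m + 1)%nat) in *.
  set (df := fun t => - (K * INR n * t ^ (2 * m)) / (1 + (K * t ^ n) * (K * t ^ n))).
  set (ddf := fun t =>
    - (K * INR n * (INR (2 * m) * t ^ pred (2 * m)))
        / (1 + (K * t ^ n) * (K * t ^ n))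
    + K * INR n * t ^ (2 * m) * (2 * (K * t ^ n) * (K * INR n * t ^ (2 * m)))
        / (1 + (K * t ^ n) * (K * t ^ n)) ^ 2).
  assert (Hpred : pred n = (2 * m)%nat) by (unfold n; lia).
  destruct (C2_near_intro (fun t => - atan (K * t ^ n)) df ddf x) as [HC HD].
  - intros y; change R in y; unfold df; auto_derive; [exact I|].
    rewrite Hpred; field; apply Hden.
  - intros y; change R in y; unfold df, ddf; auto_derive; [apply Hden|].
    change (m + (m + 0))%nat with (2 * m)%nat; rewrite Hpred; field; apply Hden.
  - intros y; apply (ex_derive_continuous (V := R_NormedModule)); unfold ddf; auto_derive.
    repeat split; try apply Hden.
    generalize (Hden (K * y ^ n)); intros H; simpl; nra.
  - split; [exact HC|]. rewrite HD; unfold ddf.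
    assert (Hx : x <> 0).
    { intros ->; unfold n in HK; rewrite Nat.add_1_r, pow_ne_zero in HK by lia; lra. }
    assert (En : INR n = 2 * INR m + 1)
      by (unfold n; rewrite plus_INR, mult_INR; reflexivity).
    assert (Em : INR (2 * m) = 2 * INR m) by (rewrite mult_INR; reflexivity).
    (* Since K x^n = 1, the lower powers K x^(n-1) and (n-1) K x^(n-2) become 1/x and (n-1)/x^2. *)
    assert (H1 : K * x ^ (2 * m) = / x).
    { apply Rmult_eq_reg_r with x; [|exact Hx].
      rewrite Rinv_l by exact Hx; rewrite <- HK; unfold n.
      rewrite pow_add, pow_1; ring. }
    assert (H2 : K * (INR (2 * m) * x ^ pred (2 * m)) = INR (2 * m) / x ^ 2).
    (* For m = 0 the exponent [pred 0] is truncated to 0, but the factor [INR (2 * m)] vanishes. *)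
    { destruct m as [|m']; [simpl; field; exact Hx|].
      apply Rmult_eq_reg_r with x; [|exact Hx].
      transitivity (INR (2 * S m') * (K * x ^ (2 * S m'))).
      - replace (2 * S m')%nat with (S (pred (2 * S m'))) at 4 by lia.
        simpl; ring.
      - rewrite H1; field; exact Hx. }
    rewrite HK.
    (* The denominators 1 + (K x^n)^2 and its square are 2 and 4; the sum is then -n(n-1)/(2x^2) +
       n^2/(2x^2) = n/(2x^2). *)
    transitivity (- (INR n * (K * (INR (2 * m) * x ^ pred (2 * m)))) / 2
      + INR n * (K * x ^ (2 * m)) * (2 * (INR n * (K * x ^ (2 * m)))) / 4).
    { field. }
    rewrite H2, H1, En, Em; field; exact Hx.
Qed.

Theorem mainTheorem9 (m : nat) (q : R) (hq : q > 2 * INR m + 3) :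
  let alpha := (q - 3 - 2 * INR m) / (q - 1) in
  let c := (1 - alpha) * Rpower alpha (1 - q) in
  let u := signed_power alpha in
  0 < alpha < 1 /\
  c > 0 /\
  ~ Lipschitz_at u 0 /\
  (* Theta is an arbitrary extension of the phase to p <= 0 *)
  forall Theta : R -> R -> R,
    (forall x p : R, p > 0 ->
       Theta x p = - atan (c * x ^ (2 * m + 1) * Rpower p q)) ->
    viscosity_solution (fun x _ p => Theta x p) (-1) 1 u /\
    (forall M : R, exists x p : R,
       -1 < x < 1 /\
       (exists y : R, 0 < Rabs y < 1 /\ is_derive u y p) /\
       C2_near (fun t => Theta t p) x /\
       Rabs (Derive_n (fun t => Theta t p) 2 x) > M).
Proof.
  intros alpha c u.
  assert (Hm := pos_INR m).
  assert (Ea : alpha - 1 = - (2 + 2 * INR m) / (q - 1))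
    by (unfold alpha; field; lra).
  assert (Ha : 0 < alpha < 1).
  { split.
    - unfold alpha; apply Rdiv_lt_0_compat; lra.
    - assert (0 < (2 + 2 * INR m) / (q - 1)) by (apply Rdiv_lt_0_compat; lra).
      unfold Rdiv in *; lra. }
  assert (Hc : c > 0).
  { apply Rmult_lt_0_compat; [lra|apply exp_pos]. }
  (* The constant [c] is normalised so that this product is minus the coefficient alpha (alpha - 1)
     of u''. *)
  assert (Hcq : c * Rpower alpha q = (1 - alpha) * alpha).
  { unfold c; rewrite Rmult_assoc, <- Rpower_plus.
    replace (1 - q + q) with 1 by ring. rewrite Rpower_1; lra. }
  split; [exact Ha|]. split; [exact Hc|].
  split; [apply signed_power_not_Lipschitz; lra|].
  intros Theta HTheta; split.
  - apply signed_power_viscosity; [exact Ha|].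
    intros x Hx.
    assert (Hax := Rabs_pos_lt x Hx).
    (* The slope of [u] is positive off the origin, so only the prescribed part of the phase is
       evaluated. *)
    rewrite HTheta by (apply Rmult_lt_0_compat; [lra|apply exp_pos]).
    rewrite <- atan_opp; f_equal.
    rewrite odd_pow_sign, <- Rpower_mult_distr by (exact Hx || lra || apply exp_pos).
    rewrite Rpower_mult.
    (* The exponents balance because (alpha - 1)(q - 1) = -(2m + 2), the relation that determines
       [alpha]. *)
    replace (alpha - 1 - 1) with ((2 * INR m + 1) + (alpha - 1) * q)
      by (rewrite Ea; field; lra).
    rewrite (Rpower_plus (2 * INR m + 1) ((alpha - 1) * q)).
    transitivity (- (c * Rpower alpha q * sign x * Rpower (Rabs x) (2 * INR m + 1)
                     * Rpower (Rabs x) ((alpha - 1) * q))); [ring|].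
    rewrite Hcq; ring.
  - intros M.
    (* Chosen so that 1/(2x^2) = 2 (1 + |M|)^2, which exceeds M. *)
    set (x := / (2 + 2 * Rabs M)).
    assert (HM := Rabs_pos M).
    assert (Hx : 0 < x < 1).
    { unfold x; split; [apply Rinv_0_lt_compat; lra|].
      rewrite <- Rinv_1; apply Rinv_lt_contravar; lra. }
    assert (Hxn : 0 < x ^ (2 * m + 1) <= 1).
    { split; [apply pow_lt; lra|].
      rewrite <- (pow1 (2 * m + 1)); apply pow_incr; lra. }
    (* With p^q = b the argument c x^(2m+1) p^q of the arctangent equals 1. *)
    set (b := / (c * x ^ (2 * m + 1))).
    set (p := Rpower b (/ q)).
    assert (Hcx : 0 < c * x ^ (2 * m + 1)) by (apply Rmult_lt_0_compat; lra).
    assert (Hb : 0 < b) by now apply Rinv_0_lt_compat.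
    assert (Hp : 0 < p) by apply exp_pos.
    assert (Epq : Rpower p q = b).
    { unfold p; rewrite Rpower_mult, Rinv_l by lra; now apply Rpower_1. }
    (* Slopes of [u] over 0 < |y| < 1 exceed [alpha]. If p <= alpha, then 1 = c x^(2m+1) p^q <=
       x^(2m+1) alpha (1 - alpha) < 1. *)
    assert (Hap : alpha < p).
    { destruct (Rlt_le_dec alpha p) as [H|H]; [exact H|exfalso].
      assert (Hle : Rpower p q <= Rpower alpha q) by (apply Rle_Rpower_l; lra).
      rewrite Epq in Hle.
      assert (H1 : c * x ^ (2 * m + 1) * b = 1) by (unfold b; field; lra).
      assert (c * x ^ (2 * m + 1) * b <= x ^ (2 * m + 1) * ((1 - alpha) * alpha)).
      { rewrite <- Hcq.
        replace (x ^ (2 * m + 1) * (c * Rpower alpha q))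
          with (c * x ^ (2 * m + 1) * Rpower alpha q) by ring.
        apply Rmult_le_compat_l; lra. }
      assert ((1 - alpha) * alpha < 1) by nra.
      nra. }
    (* The positive solution of alpha y^(alpha-1) = p; it is below 1 because the base exceeds 1 and
       the exponent is negative. *)
    set (y := Rpower (p / alpha) (/ (alpha - 1))).
    assert (Hy0 : 0 < y) by apply exp_pos.
    assert (Hpa : 1 < p / alpha).
    { apply Rmult_lt_reg_r with alpha; [lra|].
      unfold Rdiv; rewrite Rmult_assoc, Rinv_l; lra. }
    assert (Hy1 : y < 1).
    { rewrite <- (Rpower_O (p / alpha)) by lra.
      apply Rpower_lt; [exact Hpa|apply Rinv_lt_0_compat; lra]. }
    destruct (atan_odd_power_C2 (c * Rpower p q) m x) as [HC HD].
    { rewrite Epq; unfold b; field; split; lra. }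
    (* As p > 0 is fixed, the formula holds for every [t], so x-derivatives do not see the extension
       to p <= 0. *)
    assert (Hext : forall t, - atan (c * Rpower p q * t ^ (2 * m + 1)) = Theta t p).
    { intros t; rewrite HTheta by exact Hp; do 2 f_equal; ring. }
    exists x, p; split; [lra|]. split; [|split].
    + exists y; rewrite Rabs_pos_eq by lra; split; [lra|].
      replace p with (alpha * Rpower (Rabs y) (alpha - 1)).
      * apply is_derive_signed_power; lra.
      * rewrite Rabs_pos_eq by lra; unfold y.
        rewrite Rpower_mult, Rinv_l, Rpower_1 by lra; field; lra.
    + now apply (C2_near_ext (fun t => - atan (c * Rpower p q * t ^ (2 * m + 1)))).
    + rewrite <- (Derive_n_ext _ _ 2 x Hext), HD.
      replace ((2 * INR m + 1) / (2 * x ^ 2))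
        with ((2 * INR m + 1) * (2 * (1 + Rabs M) * (1 + Rabs M)))
        by (unfold x; field; lra).
      generalize (Rle_abs M); intros HMa.
      rewrite Rabs_pos_eq by nra. nra.
Qed.
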